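(* Let $p$ be a prime, $c>1$ an integer, and let $r=r(c,p)$ be the integer such that $p^{r-1}<c-1\leq p^r$. Then the following are equivalent: (1) every $p$-group in $\mathcal{N}_c^{(2)}$ is locally nilpotent; (2) if $p$ is odd, every $p$-group of exponent dividing $p^r$ in $\mathcal{N}_c^{(2)}$ is locally nilpotent, and if $p=2$, every $2$-group of exponent dividing $2^{r+1}$ in $\mathcal{N}_c^{(2)}$ is locally nilpotent.
   Context: $\mathcal{N}_c^{(2)}$ denotes the variety of groups in which every $2$-generator subgroup (subgroup generated by two elements) is nilpotent of class at most $c$. A group is locally nilpotent if all its finitely generated subgroups are nilpotent. A $p$-group ($p$ prime) is a (possibly infinite) group in which every element has order a power of $p$. A group has exponent dividing $m$ if $g^m=1$ for all its elements $g$. *)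

(* Defs.v *)
From HB Require Import structures.
From mathcomp Require Import all_boot all_order all_algebra.
From mathcomp Require Import boolp classical_sets functions cardinality.

Set Implicit Arguments.
Unset Strict Implicit.
Unset Printing Implicit Defensive.

Local Open Scope classical_set_scope.
Local Open Scope group_scope.

(* Groups are MathComp's [groupType]s, possibly infinite.  Subsets and subgroups
   are [set G], since membership in a subgroup of an infinite group need not be
   decidable. *)

Definition is_subgroup (G : groupType) (H : set G) : Prop :=
  group_closed [in H].

Definition gen (G : groupType) (A : set G) : set G :=
  smallest (@is_subgroup G) A.

Definition comm_subgroup (G : groupType) (H K : set G) : set G :=
  gen [set z | exists2 x, H x & exists2 y, K y & z = commg x y].

(* Indexed from 0: [lower_central H n] is gamma_(n+1)(H). *)
Fixpoint lower_central (G : groupType) (H : set G) (n : nat) : set G :=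
  if n is n'.+1 then comm_subgroup (lower_central H n') H else H.

Definition nilpotent_class_le (G : groupType) (c : nat) (H : set G) : Prop :=
  lower_central H c `<=` [set 1].

Definition nilpotent_subgroup (G : groupType) (H : set G) : Prop :=
  exists c, nilpotent_class_le c H.

Definition locally_nilpotent (G : groupType) : Prop :=
  forall A : set G, finite_set A -> nilpotent_subgroup (gen A).

(* Membership in the variety N_c^(2). *)
Definition in_N2 (c : nat) (G : groupType) : Prop :=
  forall x y : G, nilpotent_class_le c (gen [set x; y]).

Definition has_order (G : groupType) (g : G) (n : nat) : Prop :=
  [/\ (0 < n)%N, g ^+ n = 1 &
      forall m, (0 < m)%N -> g ^+ m = 1 -> (n <= m)%N].

Definition p_group (p : nat) (G : groupType) : Prop :=
  forall g : G, exists k, has_order g (p ^ k)%N.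

Definition exponent_dvd (m : nat) (G : groupType) : Prop :=
  forall g : G, g ^+ m = 1.

(* Main.v *)
From HB Require Import structures.
From mathcomp Require Import all_fingroup all_solvable.
Require Import Defs.
From mathcomp Require Import all_boot all_order all_algebra.
From mathcomp Require Import boolp classical_sets cardinality.

Set Implicit Arguments.
Unset Strict Implicit.
Unset Printing Implicit Defensive.

(** Only the passage from small exponent to arbitrary [p]-groups has content.
    Put [s = r] for odd [p] and [s = r + 1] for [p = 2], and let [R] be the
    largest locally finite normal subgroup of [G].  The plan is to see that
    [G / R] has exponent dividing [p^s]: then it is locally nilpotent, hence,
    being torsion, locally finite; so [G] is locally finite by
    [locally_finite_ext], and its finitely generated subgroups are finite
    [p]-groups, which are nilpotent.

    For the exponent it is enough that, in [G / R], an element [z = q^(p^s)] of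
    order dividing [p] is trivial.  Two conjugates of [q] generate a subgroup of
    class at most [c - 1 <= p^r] ([class_two_conjugates]), and there the powers
    [q^(p^s)] and [(q^g)^(p^s)] commute ([commute_powers]).  So [z] commutes with
    its conjugates, its normal closure is an abelian torsion group, hence locally
    finite, and therefore trivial modulo [R] ([quotient_exponent]).

    The heart is [commute_powers].  In a nilpotent group [H] of class at most
    [p^r], let [N] be the subgroup generated by the elements [a^(p^s)] of order
    dividing [p]; it is normal.  For odd [p] the group [N / gamma_3 N] has class
    at most two and exponent [p], so the Baer correspondence turns it into an elementary
    abelian group on which every [a] in [H] acts by a unipotent linear map [1 + D]
    with [D^(p^r) = 0]; hence [a^(p^r)] acts as [1 + D^(p^r) = 1].  Thus the
    generators of [N] are central modulo [gamma_3 N], that is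
    [gamma_2 N = gamma_3 N], and [N], being nilpotent, is abelian.  For [p = 2]
    there is no Baer correspondence: the same argument in the abelian group
    [N / gamma_2 N] shows only that [a^(2^r)] acts trivially on that quotient, and
    one further squaring makes the action on [N / gamma_3 N] trivial. *)

(** * Subgroups, generation and the lower central series *)

Section Subgroups.
Local Open Scope classical_set_scope.
Local Open Scope group_scope.

Section OneGroup.
Variable G : groupType.
Implicit Types (A B H K L M : set G) (x y z a b : G).

Lemma commgMl x y z : [~ x * y, z] = [~ x, z] ^ y * [~ y, z].
Proof. by rewrite /commg /conjg !gnorm. Qed.

Lemma commgMr x y z : [~ x, y * z] = [~ x, z] * [~ x, y] ^ z.
Proof. by rewrite /commg /conjg !gnorm. Qed.

Lemma commgVl x y : [~ x^-1, y] = ([~ x, y]^-1) ^ x^-1.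
Proof. by rewrite /commg /conjg !gnorm. Qed.

Lemma commgVr x y : [~ x, y^-1] = ([~ x, y]^-1) ^ y^-1.
Proof. by rewrite /commg /conjg !gnorm. Qed.

Lemma is_subgroupP H :
  is_subgroup H <-> H 1 /\ forall x y, H x -> H y -> H (x * y^-1).
Proof.
split=> -[H1 HM]; split.
- by move: H1; rewrite inE.
- by move=> x y Hx Hy; move: (HM x y); rewrite !inE; apply.
- by rewrite inE.
- by move=> x y; rewrite !inE; apply: HM.
Qed.

Lemma sg1 H : is_subgroup H -> H 1.
Proof. by case/is_subgroupP. Qed.

Lemma sgV H x : is_subgroup H -> H x -> H x^-1.
Proof. by case/is_subgroupP=> H1 Hd Hx; rewrite -[_^-1]mul1g; apply: Hd. Qed.

Lemma sgM H x y : is_subgroup H -> H x -> H y -> H (x * y).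
Proof.
move=> sH Hx Hy; rewrite -[y]invgK.
by case/is_subgroupP: (sH) => _; apply=> //; apply: sgV.
Qed.

Lemma sgX H x n : is_subgroup H -> H x -> H (x ^+ n).
Proof.
move=> sH Hx; elim: n => [|n IH]; first by rewrite expg0; apply: sg1.
by rewrite expgS; apply: sgM.
Qed.

Lemma sgJ H x y : is_subgroup H -> H x -> H y -> H (x ^ y).
Proof. by move=> sH Hx Hy; do !apply: sgM => //; apply: sgV. Qed.

Lemma sgR H x y : is_subgroup H -> H x -> H y -> H [~ x, y].
Proof.
by move=> sH Hx Hy; apply: sgM => //; [apply: sgV | apply: sgJ].
Qed.

Lemma is_subgroupI H :
    H 1 -> (forall x y, H x -> H y -> H (x * y)) ->
    (forall x, H x -> H x^-1) -> is_subgroup H.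
Proof. by move=> H1 HM HV; apply/is_subgroupP; split=> // x y ? ?; auto. Qed.

Lemma setI_subgroup H K :
  is_subgroup H -> is_subgroup K -> is_subgroup (H `&` K).
Proof.
move=> sH sK; apply: is_subgroupI => [|x y [Hx Kx] [Hy Ky]|x [Hx Kx]].
- by split; apply: sg1.
- by split; apply: sgM.
- by split; apply: sgV.
Qed.

Lemma setT_subgroup : is_subgroup [set: G].
Proof. exact: is_subgroupI. Qed.

Lemma set1_subgroup : is_subgroup [set (1 : G)].
Proof.
apply: is_subgroupI => //= [x y -> ->|x ->]; first by rewrite mulg1.
by rewrite invg1.
Qed.

Lemma gen_subgroup A : is_subgroup (gen A).
Proof.
apply: is_subgroupI.
- by move=> H [sH _]; apply: sg1.
- by move=> x y gx gy H HA; case: (HA) => sH _; apply: sgM; [|apply: gx|apply: gy].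
- by move=> x gx H HA; case: (HA) => sH _; apply: sgV; [|apply: gx].
Qed.

Lemma gen_incl A : A `<=` gen A.
Proof. exact: sub_gen_smallest. Qed.

Lemma gen_min A H : is_subgroup H -> A `<=` H -> gen A `<=` H.
Proof. exact: smallest_sub. Qed.

Definition normalised_by H K := forall x k, H x -> K k -> K (k ^ x).

Lemma gen_normalised H A : normalised_by H A -> normalised_by H (gen A).
Proof.
move=> nHA x k Hx; move: k.
suff: gen A `<=` [set k | gen A (k ^ x)] by [].
apply: gen_min => [|a Aa]; last by apply: gen_incl; apply: nHA.
have sA := gen_subgroup A.
apply: is_subgroupI => /= [|y z gy gz|y gy].
- by rewrite conj1g; apply: (sg1 sA).
- by rewrite conjMg; apply: (sgM sA).
- by rewrite conjVg; apply: (sgV sA).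
Qed.

Lemma comm_sub H K M : is_subgroup M ->
  (forall x y, H x -> K y -> M [~ x, y]) -> comm_subgroup H K `<=` M.
Proof. by move=> sM HKM; apply: gen_min => // _ [x Hx [y Ky ->]]; apply: HKM. Qed.

Lemma mem_comm H K x y : H x -> K y -> comm_subgroup H K [~ x, y].
Proof. by move=> Hx Ky; apply: gen_incl; exists x => //; exists y. Qed.

Lemma comm_normalised L H K : normalised_by L H -> normalised_by L K ->
  normalised_by L (comm_subgroup H K).
Proof.
move=> nH nK; apply: gen_normalised => x _ Lx [y Hy [z Kz ->]].
by rewrite conjRg; exists (y ^ x); [apply: nH|exists (z ^ x) => //; apply: nK].
Qed.

(** The elements commuting modulo [M] with a fixed one form a subgroup, as [M] is
    normal; this is used first on the left and then on the right. *)
Lemma comm_gen A B M : is_subgroup M ->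
    normalised_by (gen A) M -> normalised_by (gen B) M ->
    (forall a b, A a -> B b -> M [~ a, b]) ->
  forall x y, gen A x -> gen B y -> M [~ x, y].
Proof.
move=> sM nA nB AB.
have sA := gen_subgroup A; have sB := gen_subgroup B.
have AgB b : B b -> gen A `<=` [set x | gen A x /\ M [~ x, b]].
  move=> Bb; apply: gen_min => [|a Aa]; last by split; [apply: gen_incl|apply: AB].
  apply: is_subgroupI => /= [|x y [gx Mx] [gy My]|x [gx Mx]].
  - by split; [apply: (sg1 sA)|rewrite comm1g; apply: sg1].
  - split; first exact: (sgM sA).
    by rewrite commgMl; apply: sgM => //; apply: nA.
  - split; first exact: (sgV sA).
    by rewrite commgVl; apply: nA; [apply: (sgV sA)|apply: sgV].
move=> x y gx; move: y.
suff: gen B `<=` [set y | gen B y /\ M [~ x, y]] by move=> h y /h [].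
apply: gen_min => [|b Bb]; last by split; [apply: gen_incl|case: (AgB b Bb _ gx)].
apply: is_subgroupI => /= [|y z [gy My] [gz Mz]|y [gy My]].
- by split; [apply: (sg1 sB)|rewrite commg1; apply: sg1].
- split; first exact: (sgM sB).
  by rewrite commgMr; apply: sgM => //; apply: nB.
- split; first exact: (sgV sB).
  by rewrite commgVr; apply: nB; [apply: (sgV sB)|apply: sgV].
Qed.

Lemma lower_central_subgroup H n : is_subgroup H -> is_subgroup (lower_central H n).
Proof. by case: n => // n _; apply: gen_subgroup. Qed.

Lemma lower_central_normalised L H n :
  normalised_by L H -> normalised_by L (lower_central H n).
Proof. by move=> nH; elim: n => //= n IH; apply: comm_normalised. Qed.

Lemma subgroup_normalised H : is_subgroup H -> normalised_by H H.
Proof. by move=> sH x k Hx Hk; apply: sgJ. Qed.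

Lemma lower_centralS_sub H n :
  is_subgroup H -> lower_central H n.+1 `<=` lower_central H n.
Proof.
move=> sH; have sn := lower_central_subgroup n sH.
apply: comm_sub => // x y Hx Hy; apply: sgM => //; first exact: sgV.
by apply: (lower_central_normalised (subgroup_normalised sH)).
Qed.

Lemma lower_central_anti H m n : is_subgroup H -> (m <= n)%N ->
  lower_central H n `<=` lower_central H m.
Proof.
move=> sH; elim: n => [|n IH]; first by rewrite leqn0 => /eqP ->.
rewrite leq_eqVlt => /orP[/eqP -> //|]; rewrite ltnS => /IH h x Hx.
by apply: h; apply: lower_centralS_sub.
Qed.

Lemma lower_central_mono H K n : H `<=` K ->
  lower_central H n `<=` lower_central K n.
Proof.
move=> HK; elim: n => //= n IH; apply: comm_sub; first exact: gen_subgroup.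
by move=> x y Hx Hy; apply: mem_comm; [apply: IH|apply: HK].
Qed.

Lemma lower_central_derived H n : is_subgroup H ->
  lower_central (lower_central H 1) n `<=` lower_central H n.+1.
Proof.
move=> sH; elim: n => // n IH; apply: comm_sub; first exact: gen_subgroup.
move=> x y Hx Hy; apply: mem_comm; first exact: IH.
exact: lower_centralS_sub Hy.
Qed.

End OneGroup.
End Subgroups.

(** * Morphisms, subquotients and two conjugates *)

Section Morphisms.
Local Open Scope classical_set_scope.
Local Open Scope group_scope.

Definition morphism_on (G Q : groupType) (H : set G) (f : G -> Q) :=
  forall x y, H x -> H y -> f (x * y) = f x * f y.

Section Hom.
Variables (G Q : groupType) (H : set G) (f : G -> Q).
Hypotheses (sH : is_subgroup H) (fM : morphism_on H f).
Implicit Types (A K L : set G) (x y : G).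

Lemma mor1 : f 1 = 1.
Proof.
have := fM (sg1 sH) (sg1 sH); rewrite mulg1 => h.
by apply: (mulgI (f 1)); rewrite -h mulg1.
Qed.

Lemma morV x : H x -> f x^-1 = (f x)^-1.
Proof.
move=> Hx; apply: (mulgI (f x)).
by rewrite -fM ?mulgV ?mor1 //; apply: sgV.
Qed.

Lemma morX x n : H x -> f (x ^+ n) = f x ^+ n.
Proof.
move=> Hx; elim: n => [|n IH]; first by rewrite !expg0 mor1.
by rewrite !expgS fM ?IH //; apply: sgX.
Qed.

Lemma morJ x y : H x -> H y -> f (x ^ y) = f x ^ f y.
Proof.
move=> Hx Hy; rewrite /conjg !fM ?morV //; try exact: sgV.
exact: sgM.
Qed.

Lemma morR x y : H x -> H y -> f [~ x, y] = [~ f x, f y].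
Proof.
move=> Hx Hy; rewrite /commg fM ?morV ?morJ //; first exact: sgV.
exact: sgJ.
Qed.

Lemma mor_image_subgroup K : is_subgroup K -> K `<=` H -> is_subgroup (f @` K).
Proof.
move=> sK KH; apply: is_subgroupI => [|_ _ [x Kx <-] [y Ky <-]|_ [x Kx <-]].
- by exists 1; [apply: sg1|apply: mor1].
- by exists (x * y); [apply: sgM|rewrite fM //; apply: KH].
- by exists (x^-1); [apply: sgV|rewrite morV //; apply: KH].
Qed.

Lemma mor_preimage_subgroup (L : set Q) :
  is_subgroup L -> is_subgroup (H `&` f @^-1` L).
Proof.
move=> sL; apply: is_subgroupI => [|x y [Hx Lx] [Hy Ly]|x [Hx Lx]].
- by split; [apply: sg1|rewrite /= mor1; apply: sg1].
- by split; [apply: sgM|rewrite /= fM //; apply: sgM].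
- by split; [apply: sgV|rewrite /= morV //; apply: sgV].
Qed.

Lemma image_gen A : A `<=` H -> f @` gen A = gen (f @` A).
Proof.
move=> AH; have gH : gen A `<=` H by apply: gen_min.
apply/seteqP; split.
  move=> _ [x gx <-].
  suff: gen A `<=` H `&` f @^-1` gen (f @` A) by move=> /(_ x gx) [].
  apply: gen_min (mor_preimage_subgroup (gen_subgroup _)) _ => a Aa.
  by split; [apply: AH|rewrite /=; apply: gen_incl; exists a].
apply: gen_min (mor_image_subgroup (gen_subgroup A) gH) _.
by move=> _ [a Aa <-]; exists a => //; apply: gen_incl.
Qed.

Lemma image_lower_central K n : is_subgroup K -> K `<=` H ->
  lower_central (f @` K) n = f @` lower_central K n.
Proof.
move=> sK KH; have Hn m : lower_central K m `<=` H.
  by move=> x /(lower_central_anti sK (leq0n m)) /KH.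
elim: n => //= n IH.
have cH : [set z | exists2 x, lower_central K n x & exists2 y, K y & z = [~ x, y]]
            `<=` H.
  by move=> _ [x /Hn Hx [y /KH Hy ->]]; apply: sgR.
rewrite IH /comm_subgroup image_gen //; congr gen; apply/seteqP; split.
  move=> _ [_ [x Kx <-] [_ [y Ky <-] ->]].
  exists [~ x, y]; first by exists x => //; exists y.
  by rewrite morR //; [apply: Hn Kx|apply: KH].
move=> _ [_ [x Kx [y Ky ->]] <-].
exists (f x); first by exists x.
exists (f y); first by exists y.
by rewrite morR //; [apply: Hn Kx|apply: KH].
Qed.

Lemma image_class_le K c : is_subgroup K -> K `<=` H ->
  nilpotent_class_le c K -> nilpotent_class_le c (f @` K).
Proof.
move=> sK KH Kc; rewrite /nilpotent_class_le image_lower_central //.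
by move=> _ [x /Kc -> <-]; apply: mor1.
Qed.

End Hom.

Lemma image2 (T U : Type) (f : T -> U) a b :
  f @` [set a; b] = [set f a; f b].
Proof. by rewrite image_setU !image_set1. Qed.

Lemma in_N2_image (G Q : groupType) (f : G -> Q) c :
    morphism_on setT f -> (forall q, exists2 x, setT x & f x = q) ->
  in_N2 c G -> in_N2 c Q.
Proof.
move=> fM fsurj Gc x y; case: (fsurj x) (fsurj y) => [a _ <-] [b _ <-].
have sT := setT_subgroup G.
rewrite -image2 -(image_gen sT fM) //.
exact: (image_class_le sT fM (gen_subgroup _)).
Qed.

(** The group [H / K], carried by a system of representatives of the cosets
    [x K] of [K] in [H]; taking [K] trivial turns a subgroup into a group. *)
Lemma subquotient (G : groupType) (H K : set G) :
    is_subgroup H -> is_subgroup K -> K `<=` H -> normalised_by H K ->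
  exists (Q : groupType) (f : G -> Q),
    [/\ morphism_on H f, forall x, H x -> (f x = 1 <-> K x) &
        forall q, exists2 x, H x & f x = q].
Proof.
move=> sH sK KH nK.
pose coset x := [set y | H y /\ K (x^-1 * y)].
pose rep x := xget 1 (coset x).
have repP x : H x -> coset x (rep x).
  by move=> Hx; apply: xgetPex; exists x; split=> //; rewrite mulVg; apply: sg1.
have rep_eq x y : H x -> H y -> (rep x = rep y <-> K (x^-1 * y)).
  move=> Hx Hy; split=> [e|Kxy].
    have [_ Kx] := repP x Hx; have [_ Ky] := repP y Hy.
    have := sgM sK Kx (sgV sK Ky).
    by rewrite e !gnorm.
  congr (xget 1 _); apply/seteqP; split=> z [Hz Kz]; split=> //.
    by have := sgM sK (sgV sK Kxy) Kz; rewrite !gnorm.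
  by have := sgM sK Kxy Kz; rewrite !gnorm.
have Hrep x : H x -> H (rep x) by move=> /repP [].
have repK x : H x -> rep (rep x) = rep x.
  move=> Hx; apply/rep_eq => //; first exact: Hrep.
  by case: (repP x Hx) => _ Kx; have := sgV sK Kx; rewrite !gnorm.
pose T := {x : G | `[< H x /\ rep x = x >]}.
have mkP x : H x -> `[< H (rep x) /\ rep (rep x) = rep x >].
  by move=> Hx; apply/asboolP; split; [apply: Hrep|apply: repK].
have one_P : `[< H (rep 1) /\ rep (rep 1) = rep 1 >] by apply: mkP; apply: sg1.
pose mk x : T := insubd (Sub (rep 1) one_P) (rep x).
have val_mk x : H x -> \val (mk x) = rep x.
  by move=> Hx; rewrite /mk val_insubd mkP.
have HT (u : T) : H (\val u) by case: u => x /= /asboolP [].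
have repT (u : T) : rep (\val u) = \val u by case: u => x /= /asboolP [].
have mkT (u : T) : mk (\val u) = u.
  by apply: val_inj; rewrite val_mk ?repT.
have mk_eq x y : H x -> H y -> (mk x = mk y <-> K (x^-1 * y)).
  move=> Hx Hy; rewrite -rep_eq //; split=> [e|e]; last by rewrite /mk e.
  by rewrite -!val_mk // e.
have mk_rep x : H x -> mk (rep x) = mk x by move=> Hx; rewrite /mk repK.
have mkMl x y : H x -> H y -> mk (rep x * y) = mk (x * y).
  move=> Hx Hy; apply/mk_eq; [apply: sgM => //; exact: Hrep|exact: sgM|].
  case: (repP x Hx) => _ Kx.
  have := nK _ _ Hy (sgV sK Kx).
  by rewrite /conjg !gnorm.
have mkMr x y : H x -> H y -> mk (x * rep y) = mk (x * y).
  move=> Hx Hy; apply/mk_eq; [apply: sgM => //; exact: Hrep|exact: sgM|].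
  case: (repP y Hy) => _ Ky.
  by have := sgV sK Ky; rewrite !gnorm.
have H1 := sg1 sH.
have HM x y : H x -> H y -> H (x * y) by apply: sgM.
have HV x : H x -> H x^-1 by apply: sgV.
pose mulT (u v : T) := mk (\val u * \val v).
pose invT (u : T) := mk (\val u)^-1.
have mulTA : associative mulT.
  move=> u v w; rewrite /mulT !val_mk; auto.
  by rewrite mkMr ?mkMl ?mulgA; auto.
have mul1T : left_id (mk 1) mulT.
  by move=> u; rewrite /mulT val_mk // mkMl // mul1g mkT.
have mulT1 : right_id (mk 1) mulT.
  by move=> u; rewrite /mulT val_mk // mkMr // mulg1 mkT.
have mulVT : left_inverse (mk 1) invT mulT.
  by move=> u; rewrite /mulT val_mk ?mkMl ?mulVg; auto.
have mulTV : right_inverse (mk 1) invT mulT.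
  by move=> u; rewrite /mulT val_mk ?mkMr ?mulgV; auto.
pose Q : groupType :=
  HB.pack T (isGroup.Build T mulTA mul1T mulT1 mulVT mulTV).
exists Q, (mk : G -> Q); split.
- move=> x y Hx Hy; change (mk (x * y) = mulT (mk x) (mk y)).
  by rewrite /mulT !val_mk // mkMr ?mkMl; auto.
- move=> x Hx; change (mk x = mk 1 <-> K x).
  rewrite mk_eq // mulg1; split=> [/(sgV sK)|/(sgV sK) //].
  by rewrite invgK.
- by move=> u; exists (\val (u : T)) => //; apply: (mkT u).
Qed.

(** Conjugates generate less: [<a, a^x>] is generated by [a] and [[a, x]],
    which commute modulo the third term of the lower central series of [<a, x>],
    so its series runs one step ahead. *)
Lemma class_two_conjugates (G : groupType) (c : nat) (a x : G) :
  (1 < c)%N -> nilpotent_class_le c (gen [set a; x]) ->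
  nilpotent_class_le c.-1 (gen [set a; a ^ x]).
Proof.
move=> c1; set K := gen [set a; x] => Kc; set L := gen [set a; a ^ x].
have sK : is_subgroup K := gen_subgroup _.
have sL : is_subgroup L := gen_subgroup _.
have Ka : K a by apply: gen_incl; left.
have Kx : K x by apply: gen_incl; right.
have LK : L `<=` K.
  by apply: gen_min => // _ [->|->] //; apply: (sgJ sK).
pose M := lower_central K 2.
have sM : is_subgroup M by apply: lower_central_subgroup.
have nM : normalised_by K M.
  by apply: lower_central_normalised; apply: subgroup_normalised.
have L' : L = gen [set a; [~ a, x]].
  have e : a ^ x = a * [~ a, x] by rewrite /commg mulVKg.
  have sL' := gen_subgroup [set a; [~ a, x]].
  apply/seteqP; split; apply: gen_min => // _ [->|->].
  - by apply: gen_incl; left.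
  - by rewrite e; apply: (sgM sL'); apply: gen_incl; [left|right].
  - by apply: gen_incl; left.
  - apply: (sgM sL); last by apply: gen_incl; right.
    by apply: (sgV sL); apply: gen_incl; left.
have M1 y z : lower_central K 1 y -> K z -> M [~ y, z] by move=> *; apply: mem_comm.
have K1 : lower_central K 1 [~ a, x] by apply: mem_comm.
have LM y z : L y -> L z -> M [~ y, z].
  have nLM : normalised_by L M by move=> u k Lu; apply: nM; apply: LK.
  rewrite L'; apply: comm_gen; rewrite -?L' // => _ _ [->|->] [->|->].
  - by rewrite commgg; apply: (sg1 sM).
  - by rewrite -invgR; apply: (sgV sM); apply: M1.
  - by apply: M1.
  - by rewrite commgg; apply: (sg1 sM).
suff LKn n : lower_central L n.+1 `<=` lower_central K n.+2.
  by case: c c1 Kc => [|[|c]] // _ Kc y /LKn /Kc.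
elim: n => [|n IH]; first by apply: comm_sub => //.
apply: comm_sub; first exact: gen_subgroup.
by move=> y z /IH Ky /LK Kz; apply: mem_comm.
Qed.

End Morphisms.

(** * Unipotent maps on groups of class two *)

Section Frobenius.
Local Open Scope ring_scope.
Import GRing.Theory.

Lemma iter_add_binomial (V : zmodType) (D : V -> V) m v :
    D 0 = 0 -> {morph D : x y / x + y} ->
  iter m (fun x => x + D x) v = \sum_(i < m.+1) iter i D v *+ 'C(m, i).
Proof.
move=> D0 DD; have Dsum := big_morph D DD D0.
have DMn x n : D (x *+ n) = D x *+ n.
  by elim: n => [|n IH]; rewrite ?mulr0n // !mulrS DD IH.
elim: m => [|m IH]; first by rewrite big_ord1 bin0.
rewrite iterS IH Dsum; under [X in _ + X]eq_bigr => i _ do rewrite DMn -iterS.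
rewrite [RHS]big_ord_recl bin0 [X in X + _ = _]big_ord_recl bin0 -addrA.
congr (_ + _); under [RHS]eq_bigr => i _ do rewrite /= /bump add1n binS mulrnDr.
rewrite big_split /=; congr (_ + _).
by rewrite [RHS]big_ord_recr /= bin_small // mulr0n addr0.
Qed.

(** From [i * C(p^r, i) = p^r * C(p^r - 1, i - 1)]: were the binomial prime to
    [p], the factor [i < p^r] would be a multiple of [p^r]. *)
Lemma prime_dvd_bin_pow p r i : prime p -> (0 < i < p ^ r)%N -> (p %| 'C(p ^ r, i))%N.
Proof.
move=> p_pr /andP[i0 ir]; apply: contraLR (ir) => pC; rewrite -leqNgt.
have := mul_bin_diag (p ^ r) i.-1; rewrite prednK // => e.
apply: dvdn_leq => //.
have co : coprime (p ^ r) 'C(p ^ r, i) by rewrite coprimeXl // prime_coprime.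
by rewrite -(Gauss_dvdl _ co) -e dvdn_mulr.
Qed.

(** In characteristic [p], [(1 + D)^(p^r) = 1 + D^(p^r)]. *)
Lemma iter_unipotent_id (V : zmodType) (D : V -> V) p r v :
    prime p -> D 0 = 0 -> {morph D : x y / x + y} ->
    (forall x : V, x *+ p = 0) -> iter (p ^ r) D v = 0 ->
  iter (p ^ r) (fun x => x + D x) v = v.
Proof.
move=> p_pr D0 DD Vp; have dvd i := @prime_dvd_bin_pow p r i p_pr.
have : (0 < p ^ r)%N by rewrite expn_gt0 prime_gt0.
case: (p ^ r)%N dvd => // n dvd _ Dv.
rewrite iter_add_binomial // big_ord_recr big_ord_recl /=.
have -> : D (iter n D v) = 0 by [].
rewrite mul0rn addr0 bin0 mulr1n big1 ?addr0 // => i _.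
have /dvdnP[q ->] : (p %| 'C(n.+1, bump 0 i))%N.
  by apply: dvd; rewrite /bump /= add1n ltnS ltn_ord.
by rewrite mulrnA Vp.
Qed.

End Frobenius.

Section Baer.
Import GRing.Theory.
Local Open Scope classical_set_scope.
Local Open Scope group_scope.

Section ClassTwo.
Variables (Q : groupType) (k : nat).
Hypothesis class2 : forall x y z : Q, commute [~ x, y] z.
Hypothesis commX1 : forall x y : Q, [~ x, y] ^+ (k.*2.+1) = 1.
Implicit Types x y z : Q.

Lemma class2_commMl x y z : [~ x * y, z] = [~ x, z] * [~ y, z].
Proof. by rewrite commgMl /conjg class2 mulKg. Qed.

Lemma class2_commMr x y z : [~ x, y * z] = [~ x, y] * [~ x, z].
Proof. by rewrite commgMr /conjg (class2 x y z) mulKg class2. Qed.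

Lemma class2_comm_comml x y z : [~ [~ x, y], z] = 1.
Proof. by apply/eqP/commgP/class2. Qed.

Lemma class2_commXl x y n : [~ x ^+ n, y] = [~ x, y] ^+ n.
Proof.
elim: n => [|n IH]; first by rewrite !expg0 comm1g.
by rewrite !expgS class2_commMl IH.
Qed.

(** In class two, [[x, y]^p = [x^p, y]] and the [x] with all these trivial form a
    subgroup. *)
Lemma class2_comm_exp p (S : set Q) : (forall x, gen S x) ->
  (forall x, S x -> x ^+ p = 1) -> forall x y, [~ x, y] ^+ p = 1.
Proof.
move=> genS Sp x y; suff: gen S `<=` [set x | [~ x, y] ^+ p = 1] by apply.
apply: gen_min => [|z /Sp zp]; last by rewrite /= -class2_commXl zp comm1g.
apply: is_subgroupI => /= [|u v up vp|u up].
- by rewrite comm1g expg1n.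
- by rewrite class2_commMl expgMn ?up ?vp ?mulg1 //; apply: class2.
- by rewrite commgVl -conjXg expVgn up invg1 conj1g.
Qed.

(** The Baer correspondence: correcting the product by the square root
    [[x, y]^k] of [[y, x]] makes it commutative. *)
Definition baer_add x y := x * y * [~ x, y] ^+ k.

Let centX x y n z : commute ([~ x, y] ^+ n) z.
Proof. by apply/commute_sym/commuteX/commute_sym/class2. Qed.

Let commMcl x y z n t : [~ x * [~ y, z] ^+ n, t] = [~ x, t].
Proof. by rewrite class2_commMl class2_commXl class2_comm_comml expg1n mulg1. Qed.

Let commMcr x y z n t : [~ t, x * [~ y, z] ^+ n] = [~ t, x].
Proof. by rewrite -invgR commMcl invgR. Qed.

Lemma baer_addA : associative baer_add.
Proof.
move=> x y z; rewrite /baer_add commMcl commMcr class2_commMl class2_commMr.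
have XM (u v w t : Q) : ([~ u, v] * [~ w, t]) ^+ k = [~ u, v] ^+ k * [~ w, t] ^+ k.
  by rewrite expgMn //; apply: class2.
rewrite !XM -!mulgA; congr (x * (y * _)).
rewrite (centX x y k (z * _)) -!mulgA; congr (z * _).
by rewrite [RHS](centX x z) mulgA.
Qed.

Lemma baer_addC : commutative baer_add.
Proof.
move=> x y; rewrite /baer_add [x * y]commgC -[LHS]mulgA; congr (_ * _).
rewrite -expgS -[[~ y, x]]invgR; apply: (mulIg ([~ x, y] ^+ k)).
by rewrite -expgnDr addSn addnn commX1 expVgn mulVg.
Qed.

Lemma baer_add1 : left_id 1 baer_add.
Proof. by move=> x; rewrite /baer_add mul1g comm1g expg1n mulg1. Qed.

Lemma baer_addV : left_inverse 1 (fun x => x^-1) baer_add.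
Proof.
by move=> x; rewrite /baer_add mulVg -invgR commgVg invg1 expg1n mulg1.
Qed.

(** An endomorphism of a group is also one of its Baer addition, and [W] provides
    the nilpotency of [D x = s x - x]: the Baer difference of [s x] and [x] differs
    from [x^-1 * s x] only by a conjugation and commutators with it, so [D] too
    moves each [W n] into [W n.+1]. The hypothesis on [S] makes the additive group
    elementary abelian. *)
Lemma class2_unipotent_id (p r : nat) (S : set Q) (s : Q -> Q)
    (W : nat -> set Q) :
    prime p -> (forall x y : Q, [~ x, y] ^+ k ^+ p = 1) ->
    (forall x, gen S x) -> (forall x, S x -> x ^+ p = 1) ->
    {morph s : x y / x * y} ->
    (forall n, is_subgroup (W n)) -> (forall n, normalised_by setT (W n)) ->
    (forall x, W 0%N x) -> (forall n x, W n x -> W n.+1 (x^-1 * s x)) ->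
    W (p ^ r)%N `<=` [set 1] ->
  forall x, iter (p ^ r) s x = x.
Proof.
move=> p_pr ckp genS Sp sM sW nW W0 WS Wend.
pose Z : zmodType := HB.pack Q
  (GRing.isZmodule.Build Q baer_addA baer_addC baer_add1 baer_addV).
have addE (x y : Z) : (x + y)%R = baer_add x y by [].
have mulrnE (x : Z) n : (x *+ n)%R = x ^+ n.
  elim: n => // n IH; rewrite mulrS IH addE /baer_add expgS.
  by rewrite commgXg expg1n mulg1.
have zp (x : Z) : (x *+ p)%R = 0%R.
  suff: gen S `<=` [set x : Q | x ^+ p = 1].
    by move=> /(_ x (genS x)) /= h; rewrite mulrnE h.
  apply: gen_min => //; apply: is_subgroupI => /= [|y z yp zp|y yp].
  - exact: expg1n.
  (* the product is the Baer sum up to a central factor of order dividing [p] *)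
  - have -> : y * z = baer_add y z * [~ z, y] ^+ k.
      by rewrite /baer_add -[[~ z, y]]invgR expVgn mulgK.
    rewrite expgMn; last by apply/commute_sym/centX.
    have -> : baer_add y z ^+ p = ((y : Z) *+ p + (z : Z) *+ p)%R.
      by rewrite -mulrnE -addE mulrnDl.
    by rewrite !mulrnE yp zp ckp addE baer_add1 mulg1.
  - by rewrite expVgn yp invg1.
have s1 : s 1 = 1 by apply: (mulgI (s 1)); rewrite -sM !mulg1.
have sV x : s x^-1 = (s x)^-1.
  by apply: (mulgI (s x)); rewrite -sM !mulgV.
have sX x n : s (x ^+ n) = s x ^+ n.
  by elim: n => [|n IH]; rewrite ?expg0 // !expgS sM IH.
have sadd (x y : Z) : s (x + y)%R = ((s x : Z) + (s y : Z))%R.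
  by rewrite !addE /baer_add !sM sX /commg /conjg !sM !sV.
pose D (x : Z) : Z := ((s x : Z) - x)%R.
have DE : s =1 (fun x : Z => (x + D x)%R) by move=> x; rewrite /D addrC subrK.
have DW n x : W n x -> W n.+1 (D x).
  move=> Wx; rewrite /D addE; change (- (x : Z))%R with (x^-1 : Q).
  set u := x^-1 * s x; have Wu : W n.+1 u by apply: WS.
  have -> : s x = x * u by rewrite /u mulVKg.
  have sn := sW n.+1.
  apply: (sgM sn).
    by have := @nW n.+1 x^-1 u I Wu; rewrite /conjg invgK mulgA.
  apply: (sgX _ sn); rewrite class2_commMl commgVg mul1g.
  by apply: (sgM sn); [apply: (sgV sn)|apply: nW].
move=> x; rewrite (eq_iter DE).
have D0 : D 0%R = 0%R by rewrite /D s1 subrr.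
have DD : {morph D : x y / (x + y)%R}.
  by move=> y z; rewrite /D sadd opprD addrACA.
apply: (@iter_unipotent_id Z D p r x) => //; apply: Wend.
have: forall n, W n (iter n D x) by elim=> //= n IH; apply: DW.
exact.
Qed.

End ClassTwo.

End Baer.

(** * Commuting powers in nilpotent groups *)

Section Powers.
Local Open Scope classical_set_scope.
Local Open Scope group_scope.

Section InNilpotent.
Variables (G : groupType) (H : set G) (p r : nat).
Hypotheses (sH : is_subgroup H) (p_pr : prime p).
Hypothesis (Hclass : nilpotent_class_le (p ^ r) H).

(** On [gen S / K], of class at most two and exponent [p], conjugation by [a] is unipotent
    of index at most [p^r] along the traces of the lower central series of [H].
    Halving commutators, as the Baer addition requires, is possible when [p] is
    odd or when all commutators are trivial. *)
Lemma conj_power_trivial (S K : set G) a :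
    S `<=` H -> normalised_by H S -> (forall x, S x -> x ^+ p = 1) ->
    is_subgroup K -> K `<=` gen S -> normalised_by H K ->
    lower_central (gen S) 2 `<=` K ->
    odd p \/ lower_central (gen S) 1 `<=` K -> H a ->
  forall v, gen S v -> K [~ v, a ^+ (p ^ r)].
Proof.
set N := gen S => SH nHS Sp sK KN nHK K2 K1 Ha v Nv.
have sN : is_subgroup N := gen_subgroup _.
have NH : N `<=` H by apply: gen_min.
have nHN : normalised_by H N by apply: gen_normalised.
have nNK : normalised_by N K by move=> x k /NH; apply: nHK.
have [Q [f [fM fK fsurj]]] := subquotient sN sK KN nNK.
have lift (q : Q) : exists x, N x /\ f x = q.
  by case: (fsurj q) => x; exists x.
pose g (q : Q) : G := sval (cid (lift q)).
have gN q : N (g q) by rewrite /g; case: cid => ? [].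
have gK q : f (g q) = q by rewrite /g; case: cid => ? [].
have f_eq x y : N x -> N y -> (f x = f y <-> K (x^-1 * y)).
  move=> Nx Ny; have Nxy : N (x^-1 * y) by apply: (sgM sN) => //; apply: (sgV sN).
  rewrite -(fK _ Nxy) fM ?(morV sN fM) //; last exact: (sgV sN).
  split=> [->|h]; first by rewrite mulVg.
  by apply: (mulgI (f x)^-1); rewrite h mulVg.
pose s (q : Q) : Q := f (g q ^ a).
have sE x : N x -> s (f x) = f (x ^ a).
  move=> Nx; apply/f_eq; [exact: nHN|exact: nHN|].
  rewrite -conjVg -conjMg; apply: nHK => //.
  by apply/f_eq.
have sM : {morph s : x y / x * y}.
  move=> x y; rewrite -[x]gK -[y]gK -fM // !sE //; last exact: (sgM sN).
  by rewrite conjMg fM //; apply: nHN.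
have class2 (x y z : Q) : commute [~ x, y] z.
  apply/commgP/eqP; rewrite -[x]gK -[y]gK -[z]gK.
  have Nxy : N [~ g x, g y] by apply: (sgR sN).
  rewrite -!(morR sN fM) //; apply/fK; first exact: (sgR sN).
  by apply: K2; do 2?[apply: mem_comm => //].
have genS q : gen (f @` S) q.
  rewrite -(image_gen sN fM); last exact: gen_incl.
  by exists (g q); [apply: gN|apply: gK].
have S'p q : (f @` S) q -> q ^+ p = 1.
  case=> x Sx <-; have Nx : N x by apply: gen_incl.
  by rewrite -(morX sN fM) // Sp // (mor1 sN fM).
have c_p := class2_comm_exp class2 genS S'p.
have [k [ck ckp]] : exists k, (forall x y : Q, [~ x, y] ^+ k.*2.+1 = 1) /\
    (forall x y : Q, [~ x, y] ^+ k ^+ p = 1).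
  (* [k = (p - 1) / 2] makes [2 k + 1] equal to [p]; [k = 0] is ordinary addition *)
  case: K1 => [p_odd|K1].
    exists p./2; split=> x y; last by rewrite expgnAC c_p expg1n.
    by rewrite -[X in _ ^+ X](_ : p = _) // -[LHS]odd_double_half p_odd.
  exists 0; split=> x y; rewrite ?expg0 ?expg1n // expg1.
  rewrite -[x]gK -[y]gK -(morR sN fM) //; apply/fK; first exact: (sgR sN).
  by apply: K1; apply: mem_comm.
pose W n := f @` (N `&` lower_central H n).
have sW0 n : is_subgroup (N `&` lower_central H n).
  by apply: setI_subgroup => //; apply: lower_central_subgroup.
have WN n : N `&` lower_central H n `<=` N by move=> x [].
have fs m x : N x -> iter m s (f x) = f (x ^ (a ^+ m)).
  move=> Nx; elim: m => [|m IH]; first by rewrite expg0 conjg1.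
  rewrite iterS IH sE ?expgSr ?conjgM //.
  by apply: nHN => //; apply: sgX.
suff e : iter (p ^ r) s (f v) = f v.
  have Hb : H (a ^+ (p ^ r)) by apply: sgX.
  apply/f_eq => //; first exact: nHN.
  by rewrite -fs.
apply: (class2_unipotent_id class2 ck (W := W) p_pr ckp genS S'p sM).
- by move=> n; apply: (mor_image_subgroup sN fM).
- move=> n x _ _ [y [Ny Hy] <-]; rewrite -[x]gK -(morJ sN fM) //.
  exists (y ^ g x) => //; split; first exact: (sgJ sN).
  by apply: (lower_central_normalised (subgroup_normalised sH)) => //; apply: NH.
- by move=> x; exists (g x) => //; split=> //; apply: NH.
- move=> n _ [x [Nx Hx] <-]; rewrite sE //.
  exists [~ x, a]; last first.
    by rewrite /commg fM ?(morV sN fM) //; [apply: (sgV sN)|apply: nHN].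
  split; last exact: mem_comm.
  by apply: (sgM sN); [apply: (sgV sN)|apply: nHN].
- by move=> _ [x [Nx /Hclass ->] <-]; apply: (mor1 sN fM).
Qed.

(** Two equal consecutive terms of the lower central series force all later terms
    to be equal to them. *)
Lemma lower_central_stall (N : set G) n c : lower_central N n `<=` lower_central N n.+1 ->
  nilpotent_class_le (n + c) N -> nilpotent_class_le n N.
Proof.
move=> st Nc x; suff: forall m, lower_central N n `<=` lower_central N (n + m).
  by move=> /(_ c x) h /h /Nc.
elim=> [|m IH]; first by rewrite addn0.
move=> y /st; rewrite addnS /=; apply: comm_sub; first exact: gen_subgroup.
by move=> u v /IH Hu Nv; apply: mem_comm.
Qed.

(** Modulo [M] the group [gen S] is abelian, so its squares are products of squares
    of generators. *)
Lemma square_gen (S M : set G) : is_subgroup M -> normalised_by (gen S) M ->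
    (forall x y, gen S x -> gen S y -> M [~ x, y]) ->
    (forall x, S x -> M (x ^+ 2)) ->
  forall x, gen S x -> M (x ^+ 2).
Proof.
move=> sM nM M1 S2; have sS := gen_subgroup S.
suff: gen S `<=` gen S `&` [set x | M (x ^+ 2)] by move=> h x /h [].
apply: gen_min => [|x Sx]; last by split; [apply: gen_incl|apply: S2].
apply: is_subgroupI => /= [|x y [Sx Mx] [Sy My]|x [Sx Mx]].
- by split; [apply: (sg1 sS)|rewrite /= expg1n; apply: sg1].
- split; first exact: (sgM sS).
  have -> : (x * y) ^+ 2 = x ^+ 2 * (y ^+ 2 * [~ y, x] ^ y).
    by rewrite !expg2 /commg /conjg !gnorm.
  by apply: (sgM sM) => //; apply: (sgM sM) => //; apply: nM => //; apply: M1.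
- split; first exact: (sgV sS).
  by rewrite /= expVgn; apply: sgV.
Qed.

(** The [p]-adic exponent [s] of the powers under study: one more for [p = 2],
    where commutators of class two cannot be halved. *)
Definition power_shift := if p == 2%N then r.+1 else r.

Let s := power_shift.

(** Let [N] be generated by all the [p^s]-th powers in [H] of order dividing [p].
    These generators centralise [N] modulo [gamma_3 N], by [conj_power_trivial]
    and, for [p = 2], one more squaring; hence [gamma_2 N = gamma_3 N = 1]. *)
Lemma commute_powers a b : H a -> H b ->
    a ^+ (p ^ s.+1) = 1 -> b ^+ (p ^ s.+1) = 1 ->
  commute (a ^+ (p ^ s)) (b ^+ (p ^ s)).
Proof.
move=> Ha Hb ap bp.
pose S := [set z | exists2 x, H x & z = x ^+ (p ^ s) /\ z ^+ p = 1].
have SP x : H x -> x ^+ (p ^ s.+1) = 1 -> S (x ^+ (p ^ s)).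
  by move=> Hx xp; exists x => //; split=> //; rewrite -expgnA -expnSr.
have SH : S `<=` H by move=> _ [x Hx [-> _]]; apply: sgX.
have Sp x : S x -> x ^+ p = 1 by case=> ? _ [].
have nHS : normalised_by H S.
  move=> x _ Hx [y Hy [-> yp]]; exists (y ^ x); first exact: sgJ.
  by rewrite conjXg in yp *; split=> //; rewrite -!conjXg yp conj1g.
set N := gen S.
have sN : is_subgroup N := gen_subgroup _.
have NH : N `<=` H by apply: gen_min.
have nHN : normalised_by H N by apply: gen_normalised.
have sL n : is_subgroup (lower_central N n) by apply: lower_central_subgroup.
have nL n : normalised_by H (lower_central N n) by apply: lower_central_normalised.
have nNL n : normalised_by N (lower_central N n) by move=> x k /NH; apply: nL.
have LN n : lower_central N n `<=` N by apply: (lower_central_anti sN (leq0n n)).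
suff N2 : forall v x, N v -> S x -> lower_central N 2 [~ v, x].
  have N1 : nilpotent_class_le 1 N.
    apply: (@lower_central_stall N 1 (p ^ r)).
      apply: comm_sub => // v x Nv Nx; apply: (comm_gen (A := S) (B := S)) => //.
      by move=> u w /gen_incl Nu; apply: N2.
    move=> x Nx; apply: Hclass; apply: (lower_central_mono NH).
    by move: Nx; apply: (lower_central_anti sN); rewrite leq_addl.
  by apply/commgP/eqP/N1; apply: mem_comm; apply: gen_incl; apply: SP.
move=> v _ Nv [x Hx [-> _]].
case: (eqVneq p 2%N) => [p2|pN2]; last first.
  have -> : s = r by rewrite /s /power_shift (negPf pN2).
  apply: (conj_power_trivial (S := S)) => //.
  by left; case: (even_prime p_pr) pN2 => // ->.
have -> : s = r.+1 by rewrite /s /power_shift p2 eqxx.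
(* [y] acts trivially on [N / gamma_2 N], hence on [gamma_2 N / gamma_3 N], which
   is spanned by commutators of elements of [N]; both layers have exponent two, so
   that [[v, y^2] = [v, y]^2 [v, y, y]] lies in [gamma_3 N] *)
pose y := x ^+ (p ^ r); have Hy : H y by apply: sgX.
have -> : x ^+ (p ^ r.+1) = y ^+ 2 by rewrite /y -expgnA expnSr p2.
have yN1 u : N u -> lower_central N 1 [~ u, y].
  move=> Nu; apply: (conj_power_trivial (S := S)) => //; last by right.
  exact: lower_centralS_sub.
have N12 t u : lower_central N 1 t -> N u -> lower_central N 2 [~ t, u].
  by move=> *; apply: mem_comm.
have N21 t u : N t -> lower_central N 1 u -> lower_central N 2 [~ t, u].
  by move=> Nt Nu; rewrite -invgR; apply: (sgV (sL 2)); apply: N12.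
have sqN1 u : N u -> lower_central N 1 (u ^+ 2).
  apply: square_gen => //; first by move=> *; apply: mem_comm.
  move=> z Sz; have -> : z ^+ 2 = 1 by rewrite -[RHS](Sp z Sz) p2.
  exact: (sg1 (sL 1%N)).
have gsub : gen [set z | exists2 x, N x & exists2 y, N y & z = [~ x, y]] `<=` N.
  exact: (LN 1%N).
have sqN2 t : lower_central N 1 t -> lower_central N 2 (t ^+ 2).
  apply: square_gen => //; first by move=> u k /gsub; apply: nNL.
    by move=> u w /= Nu /gsub Nw; apply: N12.
  move=> _ [u Nu [w Nw ->]].
  have -> : [~ u, w] ^+ 2 = [~ u ^+ 2, w] * [~ u, [~ u, w]] ^ [~ u, w].
    by rewrite !expg2 /commg /conjg !gnorm.
  apply: (sgM (sL 2)); first by apply: N12 => //; apply: sqN1.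
  apply: nNL; first exact: (sgR sN).
  by apply: N21 => //; apply: mem_comm.
have yN2 t : lower_central N 1 t -> lower_central N 2 [~ t, y].
  move=> Nt; apply: (comm_gen (sL 2) (B := [set y])) Nt _; last exact: gen_incl.
  - by move=> u k /gsub; apply: nNL.
  - by move=> u k gu; apply: nL; move: u gu; apply: gen_min => // _ ->.
  move=> _ _ [u Nu [w Nw ->]] ->.
  set c := [~ u, w]; have Nc : lower_central N 1 c by apply: mem_comm.
  have Nc0 := LN 1%N _ Nc.
  pose t1 := [~ u, y]; pose t2 := [~ w, y].
  have Nt1 : lower_central N 1 t1 := yN1 _ Nu.
  have Nt2 : lower_central N 1 t2 := yN1 _ Nw.
  have Nt10 := LN 1%N _ Nt1; have Nt20 := LN 1%N _ Nt2.
  have -> : [~ c, y] = ([~ u, t2] ^ t1) ^ c * [~ c, t2 * t1] * [~ t1, w * t2].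
    by rewrite /c /t1 /t2 /commg /conjg !gnorm.
  apply: (sgM (sL 2)); first apply: (sgM (sL 2)).
  - by apply: (nNL 2) => //; apply: (nNL 2) => //; apply: N21.
  - by apply: N12 => //; apply: (sgM sN).
  - by apply: N12 => //; apply: (sgM sN).
have -> : [~ v, y ^+ 2] = [~ v, y] ^+ 2 * [~ [~ v, y], y].
  by rewrite !expg2 /commg /conjg !gnorm.
by apply: (sgM (sL 2)); [apply: sqN2|apply: yN2]; apply: yN1.
Qed.

End InNilpotent.
End Powers.

(** * Local finiteness *)

Section LocallyFinite.
Local Open Scope classical_set_scope.
Local Open Scope group_scope.

Section OneGroup.
Variable G : groupType.
Implicit Types (A B T H K L M : set G) (x y z a b : G).

Definition locally_finite K :=
  forall A, finite_set A -> A `<=` K -> finite_set (gen A).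

Lemma gen_subset_stable A (X : set G) : X 1 ->
    (forall x a, X x -> A a -> X (x * a) /\ X (x * a^-1)) ->
  gen A `<=` X.
Proof.
move=> X1 XA.
suff: gen A `<=` [set g | forall x, X x -> X (x * g) /\ X (x * g^-1)].
  by move=> h g /h /(_ 1 X1) []; rewrite mul1g.
apply: gen_min => [|a Aa x Xx]; last exact: XA.
apply: is_subgroupI => /= [x Xx|g h Xg Xh x Xx|g Xg x /Xg []].
- by rewrite invg1 mulg1.
- rewrite invgM !mulgA; split; first by case: (Xg x Xx) => /Xh [].
  by case: (Xh x Xx) => _ /Xg [].
- by rewrite invgK.
Qed.

(** Schreier's argument: if finitely many cosets [K t] cover [<A>], then [<A>]
    is the product of a finite transversal with a finitely generated, hence
    finite, subgroup of [K]. *)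
Lemma finite_gen_cosets K A T : is_subgroup K -> locally_finite K ->
    finite_set A -> finite_set T ->
    (forall h, gen A h -> exists2 t, T t & K (h * t^-1)) ->
  finite_set (gen A).
Proof.
move=> sK lK fA fT cov; have sA := gen_subgroup A.
pose T1 := T `|` [set 1].
pose A1 := A `|` (fun a => a^-1) @` A.
pose F := [set z | exists2 t, T1 t & exists2 a, A1 a & exists2 u, T1 u &
             z = t * a * u^-1].
have fT1 : finite_set T1 by rewrite finite_setU; split => //; apply: finite_set1.
have fA1 : finite_set A1 by rewrite finite_setU; split => //; apply: finite_image.
have fF : finite_set F.
  apply: (@sub_finite_set _ _
    ((fun z : G * G * G => z.1.1 * z.1.2 * z.2^-1) @` ((T1 `*` A1) `*` T1))).
    by move=> _ [t Tt [a Aa [u Tu ->]]]; exists (t, a, u).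
  by apply: finite_image; do 2?apply: finite_setX.
pose E := gen (K `&` F).
have fE : finite_set E.
  by apply: lK => [|x []//]; apply: sub_finite_set fF => x [].
have sE : is_subgroup E := gen_subgroup _.
apply: (@sub_finite_set _ _ ((fun z : G * G => z.1 * z.2) @` (E `*` T1))); last first.
  by apply: finite_image; apply: finite_setX.
suff h : gen A `<=` [set g | exists e t, [/\ E e, T1 t, g = e * t &
                            exists2 h, gen A h & K (h * t^-1)]].
  by move=> g /h [e [t [Ee Tt -> _]]]; exists (e, t).
apply: gen_subset_stable.
  exists 1, 1; split; [exact: (sg1 sE)|by right|by rewrite mulg1|].
  by exists 1; [apply: (sg1 sA)|rewrite mulgV; apply: sg1].
move=> g a [e [t [Ee Tt -> [h Ah Kh]]]] Aa.
suff step b : A1 b -> gen A b -> exists e' t', [/\ E e', T1 t', e * t * b = e' * t' &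
                            exists2 h', gen A h' & K (h' * t'^-1)].
  split; apply: step; [by left|exact: gen_incl|by right; exists a|].
  by apply: (sgV sA); apply: gen_incl.
move=> A1b Ab; have Ahb : gen A (h * b) by apply: (sgM sA).
have [u Tu Ku] := cov _ Ahb.
exists (e * (t * b * u^-1)), u; split; [|by left|by rewrite !gnorm|by exists (h * b)].
apply: (sgM sE) => //; apply: gen_incl; split.
  by have := sgM sK (sgV sK Kh) Ku; rewrite !gnorm.
by exists t => //; exists b => //; exists u => //; left.
Qed.

(** The subgroup [K <a>] consists of finitely many cosets of [K]. *)
Lemma adjoin_torsion K a n : is_subgroup K -> locally_finite K ->
    (forall k, K k -> K (k ^ a)) -> (0 < n)%N -> a ^+ n = 1 ->
  exists M, [/\ is_subgroup M, locally_finite M, K `<=` M & M a] /\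
    forall x, M x -> exists2 k, K k & exists i, x = k * a ^+ i.
Proof.
move=> sK lK nK n0 an.
pose M := [set x | exists2 k, K k & exists i, x = k * a ^+ i].
have nKX i k : K k -> K (k ^ (a ^+ i)).
  elim: i => [|i IH] Kk; first by rewrite expg0 conjg1.
  by rewrite expgSr conjgM; apply: nK; apply: IH.
have aV i : a ^- i = a ^+ (n.-1 * i).
  apply/(mulgI (a ^+ i)); rewrite mulgV -expgnDr -mulSn prednK //.
  by rewrite expgnA an expg1n.
have nKV i k : K k -> K (k ^ (a ^- i)) by rewrite aV; apply: nKX.
have sM : is_subgroup M.
  apply: is_subgroupI => [|_ _ [k Kk [i ->]] [l Kl [j ->]]|_ [k Kk [i ->]]].
  - by exists 1; [apply: sg1|exists 0; rewrite expg0 mulg1].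
  - exists (k * l ^ (a ^- i)); first by apply: sgM => //; apply: nKV.
    by exists (i + j)%N; rewrite expgnDr /conjg !gnorm.
  - exists ((k ^ (a ^+ i))^-1); first by apply: sgV => //; apply: nKX.
    by exists (n.-1 * i)%N; rewrite -aV /conjg !gnorm.
exists M; split=> //; split=> //; first last.
- by exists 1; [apply: sg1|exists 1%N; rewrite mul1g expg1].
- by move=> k Kk; exists k => //; exists 0; rewrite expg0 mulg1.
move=> A fA AM.
apply: (@finite_gen_cosets K A ((fun i => a ^+ i) @` `I_n)) => //.
  by apply: finite_image; apply: finite_II.
move=> h /(gen_min sM AM) [k Kk [i ->]]; exists (a ^+ (i %% n)).
  by exists (i %% n)%N => //=; apply: ltn_pmod.
by rewrite {1}(divn_eq i n) expgnDr mulnC expgnA an expg1n mul1g mulgK.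
Qed.

Definition torsion H := forall x, H x -> exists2 n, (0 < n)%N & x ^+ n = 1.

(** By induction on the class: the derived subgroup is locally finite, and the
    generators can be adjoined to it one by one, every intermediate subgroup
    being normal. *)
Lemma nilpotent_torsion_locally_finite L c : is_subgroup L -> torsion L ->
  nilpotent_class_le c L -> locally_finite L.
Proof.
elim: c L => [|c IH] L sL tL Lc.
  move=> A _ AL; apply: sub_finite_set (finite_set1 (1 : G)).
  by apply: gen_min (set1_subgroup G) _ => x /AL /Lc.
pose D := lower_central L 1.
have sD : is_subgroup D by apply: lower_central_subgroup.
have DL : D `<=` L by apply: lower_centralS_sub.
have lD : locally_finite D.
  apply: (IH D sD) => [x /DL /tL //|].
  by move=> x /(lower_central_derived sL) /Lc.
move=> A /finite_seqP[s ->] sA.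
suff [M [sM lM _ Ms]] : exists M, [/\ is_subgroup M, locally_finite M,
    D `<=` M /\ M `<=` L & [set` s] `<=` M].
  by apply: lM => //; apply: finite_seq.
elim: s sA => [|a s IHs] sL'.
  by exists D; split=> //; split.
have [|M [sM lM [DM ML] Ms]] := IHs.
  by move=> x xs; apply: sL'; rewrite /= inE; apply/orP; right.
have La : L a by apply: sL'; rewrite /= inE eqxx.
have [n n0 an] := tL a La.
have nM k : M k -> M (k ^ a).
  move=> Mk; have -> : k ^ a = k * [~ k, a] by rewrite /commg mulVKg.
  by apply: (sgM sM) => //; apply: DM; apply: mem_comm => //; apply: ML.
have [M' [[sM' lM' MM' M'a] M'P]] := adjoin_torsion sM lM nM n0 an.
exists M'; split=> //.
  split; first by move=> x /DM /MM'.
  move=> x /M'P [k /ML Lk [i ->]]; apply: (sgM sL) => //; exact: (sgX _ sL).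
by move=> x; rewrite /= inE => /orP[/eqP ->//|/Ms /MM'].
Qed.

Definition normal_locally_finite K :=
  [/\ is_subgroup K, normalised_by setT K & locally_finite K].

Definition set_prod K L := [set z | exists2 x, K x & exists2 y, L y & z = x * y].

Lemma set_prod_subgroup K L : is_subgroup K -> normalised_by setT K ->
  is_subgroup L -> is_subgroup (set_prod K L).
Proof.
move=> sK nK sL; apply: is_subgroupI.
- by exists 1; [apply: sg1|exists 1; [apply: sg1|rewrite mulg1]].
- move=> _ _ [x Kx [y Ly ->]] [x' Kx' [y' Ly' ->]].
  exists (x * x' ^ y^-1); first by apply: sgM => //; apply: nK.
  by exists (y * y'); [apply: sgM|rewrite /conjg !gnorm].
- move=> _ [x Kx [y Ly ->]].
  exists ((x ^ y)^-1); first by apply: sgV => //; apply: nK.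
  by exists y^-1; [apply: sgV|rewrite /conjg !gnorm].
Qed.

(** Modulo [K], a finite subset of [K L] generates the same subgroup as a finite
    subset of [L], so finitely many cosets of [K] cover what it generates. *)
Lemma normal_locally_finite_prod K L :
  normal_locally_finite K -> normal_locally_finite L ->
  normal_locally_finite (set_prod K L).
Proof.
move=> [sK nK lK] [sL nL lL]; split; first exact: set_prod_subgroup.
  move=> g _ _ [x Kx [y Ly ->]]; rewrite conjMg.
  by exists (x ^ g); [apply: nK|exists (y ^ g) => //; apply: nL].
move=> A fA AKL.
have lpart z : exists y, A z -> L y /\ K (z * y^-1).
  have [/AKL [x Kx [y Ly ->]]|nA] := pselect (A z); last by exists 1.
  by exists y; rewrite mulgK.
pose l z := sval (cid (lpart z)).
have lP z : A z -> L (l z) /\ K (z * (l z)^-1) by rewrite /l; case: cid.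
have lA : l @` A `<=` L by move=> _ [z /lP [Lz _] <-].
apply: (@finite_gen_cosets K A (gen (l @` A))) => //.
  by apply: lL => //; apply: finite_image.
have sB := gen_subgroup (l @` A).
suff: gen A `<=` set_prod K (gen (l @` A)).
  by move=> h x /h [k Kk [y gy ->]]; exists y => //; rewrite mulgK.
apply: gen_min; first exact: set_prod_subgroup.
move=> z Az; have [_ Kz] := lP z Az; exists (z * (l z)^-1) => //.
by exists (l z); [apply: gen_incl; exists z|rewrite mulgVK].
Qed.

(** A union suffices, without generating: products show that the family of locally
    finite normal subgroups is directed. *)
Definition lf_radical : set G := \bigcup_(K in normal_locally_finite) K.

Lemma normal_locally_finite1 : normal_locally_finite [set 1].
Proof.
split; first exact: set1_subgroup; first by move=> x _ _ ->; apply: conj1g.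
move=> A _ A1; apply: sub_finite_set (finite_set1 (1 : G)).
exact: gen_min (set1_subgroup G) _.
Qed.

Lemma lf_radical_directed A : finite_set A -> A `<=` lf_radical ->
  exists2 K, normal_locally_finite K & A `<=` K.
Proof.
move=> /finite_seqP[s ->]; elim: s => [|a s IH] As.
  by exists [set 1]; first exact: normal_locally_finite1.
have [|K NK sK] := IH.
  by move=> x xs; apply: As; rewrite /= inE; apply/orP; right.
have [L NL La] : lf_radical a by apply: As; rewrite /= inE eqxx.
exists (set_prod K L); first exact: normal_locally_finite_prod.
case: NK NL => gK _ _ [gL _ _].
move=> x; rewrite /= inE => /orP[/eqP ->|/sK Kx].
  by exists 1; [apply: sg1|exists a => //; rewrite mul1g].
by exists x => //; exists 1; [apply: sg1|rewrite mulg1].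
Qed.

Lemma lf_radicalP : normal_locally_finite lf_radical.
Proof.
have dir2 x y : lf_radical x -> lf_radical y ->
    exists2 K, normal_locally_finite K & K x /\ K y.
  move=> Rx Ry; have [|K NK sK] := lf_radical_directed (finite_set2 x y).
    by move=> _ [->|->].
  by exists K => //; split; apply: sK; [left|right].
split.
- apply: is_subgroupI => [|x y Rx Ry|x [K NK Kx]].
  + by exists [set 1]; first exact: normal_locally_finite1.
  + have [K NK [Kx Ky]] := dir2 x y Rx Ry.
    by exists K => //; case: NK => sK _ _; apply: sgM.
  + by exists K => //; case: NK => sK _ _; apply: sgV.
- by move=> g x _ [K NK Kx]; exists K => //; case: NK => _ nK _; apply: nK.
- move=> A fA /(lf_radical_directed fA) [K [_ _ lK] AK]; exact: lK.
Qed.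

End OneGroup.

(** A finite subset of the quotient lifts to representatives of finitely many
    cosets of [R], so [finite_gen_cosets] applies. *)
Lemma locally_finite_ext (G Q : groupType) (f : G -> Q) (R : set G) (B : set Q) :
    is_subgroup R -> locally_finite R -> morphism_on setT f ->
    (forall x, f x = 1 -> R x) -> locally_finite B ->
  locally_finite (f @^-1` B).
Proof.
move=> sR lR fM fK lB A fA AB; have sT := setT_subgroup G.
have fin : finite_set (f @` gen A).
  rewrite (image_gen sT fM) //; apply: lB; first exact: finite_image.
  by move=> _ [x /AB Bx <-].
pose g q := xget (1 : G) [set x | f x = q].
apply: (@finite_gen_cosets G R A (g @` (f @` gen A))) => //.
  exact: finite_image.
move=> h gh; exists (g (f h)); first by exists (f h) => //; exists h.
apply: fK; rewrite fM // (morV sT fM) //.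
have -> : f (g (f h)) = f h.
  by apply: (@xgetPex _ (1 : G) [set x | f x = f h]); exists h.
by rewrite mulgV.
Qed.

End LocallyFinite.

(** * Finite p-groups *)

Section FinitePGroups.
Local Open Scope classical_set_scope.
Local Open Scope group_scope.

Lemma finType_pgroup_nilpotent (gT : finGroupType) p : prime p ->
  (forall x : gT, exists k, x ^+ (p ^ k) = 1) ->
  exists c, nilpotent_class_le c [set: gT].
Proof.
move=> p_pr px; pose T := [set: gT]%G.
have pT : p.-group T.
  apply/pgroupP => q q_pr /(Cauchy q_pr)[x _ xq].
  have [k xk] := px x; have : (q %| p ^ k)%N by rewrite -xq order_dvdn xk.
  by rewrite Euclid_dvdX // => /andP[]; rewrite dvdn_prime2.
have /lcnP[n Ln] := pgroup_nil pT.
exists n => x.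
suff: forall m, lower_central [set: gT] m `<=` [set x | x \in ('L_m.+1(T))%g].
  by move=> /(_ n x) /= h /h; rewrite Ln => /set1P.
elim=> [|m IH]; first by move=> y _; rewrite /= lcn1 finset.in_setT.
apply: comm_sub.
  apply: is_subgroupI => [|y z|y] /=; first exact: group1.
  - exact: groupM.
  - by rewrite groupV.
by move=> y z /IH /= Ly _; rewrite lcnSn mem_commg // finset.in_setT.
Qed.

(** Transfer to a [finGroupType], where finite [p]-groups are known to be
    nilpotent. *)
Lemma finite_pgroup_nilpotent (G : groupType) (H : set G) p : prime p ->
    is_subgroup H -> finite_set H ->
    (forall x, H x -> exists k, x ^+ (p ^ k) = 1) ->
  nilpotent_subgroup H.
Proof.
move=> p_pr sH fH pH.
have [||Q [f [fM fK fsurj]]] := subquotient sH (set1_subgroup G).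
- by move=> _ ->; apply: sg1.
- by move=> x _ _ ->; apply: conj1g.
have fHT : f @` H = setT.
  by apply/seteqP; split=> // q _; have [x Hx <-] := fsurj q; exists x.
have : finite_set [set: Q] by rewrite -fHT; apply: finite_image.
move=> /finite_seqP[s0 s0E]; pose s := undup s0.
have sP (q : Q) : q \in s.
  by rewrite mem_undup; have : [set` s0] q by rewrite -s0E.
have pc : pcancel (index ^~ s) (fun i => nth None (map Some s) i).
  by move=> q; rewrite (nth_map 1) ?index_mem // nth_index.
have fin : Finite.axiom s.
  by move=> q; rewrite count_uniq_mem ?undup_uniq // sP.
pose gT : finGroupType := HB.pack Q (PCanIsCountable pc) (isFinite.Build Q fin).
have [|c Tc] := @finType_pgroup_nilpotent gT p p_pr.
  move=> q; have [x Hx qE] := fsurj q; have [k xk] := pH x Hx; exists k.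
  change ((q : Q) ^+ (p ^ k) = 1).
  by rewrite -qE -(morX sH fM) // xk (mor1 sH fM).
(* the group structures of [gT] and [Q] agree only up to unfolding their fields,
   so the series is carried along the identity map *)
pose h (q : gT) : Q := q.
have hM : morphism_on setT h by [].
have {}Tc : nilpotent_class_le c [set: Q].
  have := image_class_le (setT_subgroup gT) hM (setT_subgroup gT) (@subsetT _ _) Tc.
  by rewrite (_ : h @` setT = setT) //; apply/seteqP; split=> // q _; exists q.
exists c => x Hx.
have Kx : H x by apply: (lower_central_anti sH (leq0n c)).
by apply/(fK x Kx)/Tc; rewrite -fHT (image_lower_central sH fM).
Qed.

End FinitePGroups.

(** * The exponent modulo the locally finite radical *)

Section Main.
Import GRing.Theory Num.Theory.
Local Open Scope classical_set_scope.
Local Open Scope group_scope.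

Lemma p_group_pow p (G : groupType) : p_group p G ->
  forall x : G, exists k, x ^+ (p ^ k) = 1.
Proof. by move=> pG x; have [k [_ xk _]] := pG x; exists k. Qed.

Lemma p_group_of_pow p (G : groupType) : prime p ->
  (forall x : G, exists k, x ^+ (p ^ k) = 1) -> p_group p G.
Proof.
move=> p_pr px x; have [k xk] := px x.
have pk0 : (0 < p ^ k)%N by rewrite expn_gt0 prime_gt0.
pose P n := (0 < n)%N && (x ^+ n == 1).
have exP : exists n, P n by exists (p ^ k)%N; rewrite /P pk0 xk eqxx.
case: (ex_minnP exP) => n /andP[n0 /eqP xn] nmin.
have : (n %| p ^ k)%N.
  apply: contraT; rewrite /dvdn -lt0n => r0.
  suff /nmin : P (p ^ k %% n)%N by rewrite leqNgt ltn_pmod.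
  rewrite /P r0 /=; apply/eqP; move: xk.
  by rewrite {1}(divn_eq (p ^ k) n) expgnDr mulnC expgnA xn expg1n mul1g.
move=> /(dvdn_pfactor _ _ p_pr)[j _ nj]; exists j; rewrite -nj; split=> // m m0 xm.
by apply: nmin; rewrite /P m0 xm eqxx.
Qed.

(** Descending from the order of [q], it suffices that [z = q^(p^s)] is trivial as
    soon as [z^p] is. Such a [z] commutes with its conjugates, hence has a locally
    finite normal closure, whose preimage lies in the radical. *)
Lemma quotient_exponent (G Q : groupType) (f : G -> Q) p c r :
    prime p -> (1 < c)%N -> (c.-1 <= p ^ r)%N ->
    p_group p G -> in_N2 c G -> morphism_on setT f ->
    (forall x, f x = 1 <-> lf_radical x) ->
    (forall q, exists2 x, setT x & f x = q) ->
  exponent_dvd (p ^ power_shift p r) Q.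
Proof.
move=> p_pr c1 cpr pG Gc fM fK fsurj; set s := power_shift p r.
have sT := setT_subgroup G; have sTQ := setT_subgroup Q.
have [sR nR lR] := lf_radicalP G.
have Qc : in_N2 c Q := in_N2_image fM fsurj Gc.
have Qpow (q : Q) : exists k, q ^+ (p ^ k) = 1.
  have [x _ <-] := fsurj q; have [k xk] := p_group_pow pG x.
  by exists k; rewrite -(morX sT fM) // xk (mor1 sT fM).
suff step (q : Q) : q ^+ (p ^ s.+1) = 1 -> q ^+ (p ^ s) = 1.
  move=> q; have [k] := Qpow q.
  have : forall k (q : Q), q ^+ (p ^ (s + k)) = 1 -> q ^+ (p ^ s) = 1.
    elim=> [u|{}k IH u uk]; first by rewrite addn0.
    apply: step; rewrite expnSr mulnC expgnA; apply: IH.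
    by rewrite -expgnA -expnS -addnS.
  move=> h qk; apply: (h k); by rewrite expnD mulnC expgnA qk expg1n.
move=> qp; set z := q ^+ (p ^ s).
have zp : z ^+ p = 1 by rewrite /z -expgnA -expnSr.
have zcomm (g : Q) : commute z (z ^ g).
  rewrite /z conjXg; apply: (@commute_powers Q (gen [set q; q ^ g]) p r) => //.
  - exact: gen_subgroup.
  - have := class_two_conjugates c1 (Qc q g) => h x /=.
    by move=> /(lower_central_anti (gen_subgroup _) cpr) /h.
  - by apply: gen_incl; left.
  - by apply: gen_incl; right.
  - by rewrite -conjXg qp conj1g.
pose S := [set w | exists g, w = z ^ g].
pose C := gen S.
have sC : is_subgroup C := gen_subgroup _.
have nC : normalised_by setT C.
  by apply: gen_normalised => g _ _ [h ->]; exists (h * g); rewrite conjgM.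
have C1 : nilpotent_class_le 1 C.
  apply: comm_sub; first exact: set1_subgroup.
  apply: comm_gen; [exact: set1_subgroup| | |] => [x _ _ ->|x _ _ ->|].
  - exact: conj1g.
  - exact: conj1g.
  (* [z^g] and [z^h] are the conjugates by [g] of [z] and [z^(h g^-1)] *)
  move=> _ _ [g ->] [h ->]; apply/eqP/commgP.
  have /(_ (h * g^-1)) e := zcomm.
  have : commute (z ^ g) ((z ^ (h * g^-1)) ^ g).
    by rewrite /commute -!conjMg e.
  by rewrite -conjgM mulgVK.
have tC : torsion C.
  move=> x _; have [k xk] := Qpow x; exists (p ^ k)%N => //.
  by rewrite expn_gt0 prime_gt0.
have lC := nilpotent_torsion_locally_finite sC tC C1.
have [x _ xq] := fsurj z.
have Rx : lf_radical x.
  exists (f @^-1` C); last first.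
    by rewrite /= xq; apply: gen_incl; exists 1; rewrite conjg1.
  split.
  - have := mor_preimage_subgroup sT fM sC.
    by rewrite setTI.
  - move=> g y _ /= Cy; rewrite (morJ sT fM) //; exact: nC.
  - by apply: (locally_finite_ext sR lR fM) => // y /fK.
by rewrite -xq; apply/fK.
Qed.

Lemma locally_nilpotent_of_exponent p c r : prime p -> (1 < c)%N ->
    (c.-1 <= p ^ r)%N ->
    (forall G : groupType, p_group p G ->
       exponent_dvd (p ^ power_shift p r) G -> in_N2 c G -> locally_nilpotent G) ->
  forall G : groupType, p_group p G -> in_N2 c G -> locally_nilpotent G.
Proof.
move=> p_pr c1 cpr hyp G pG Gc.
have sT := setT_subgroup G; have [sR nR lR] := lf_radicalP G.
have [Q [f [fM fK fsurj]]] := subquotient sT sR (@subsetT _ _) nR.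
have {}fK x : f x = 1 <-> lf_radical x by apply: fK.
have Qexp := quotient_exponent p_pr c1 cpr pG Gc fM fK fsurj.
have Qpow (q : Q) : exists k, q ^+ (p ^ k) = 1 by exists (power_shift p r).
have Qln := hyp Q (p_group_of_pow p_pr Qpow) Qexp (in_N2_image fM fsurj Gc).
have lQ : locally_finite [set: Q].
  move=> A fA _; have [d Ad] := Qln A fA.
  apply: (nilpotent_torsion_locally_finite (gen_subgroup A) _ Ad) => //.
    move=> x _; have [k xk] := Qpow x; exists (p ^ k)%N => //.
    by rewrite expn_gt0 prime_gt0.
  exact: gen_incl.
move=> A fA; apply: (finite_pgroup_nilpotent p_pr (gen_subgroup A)).
  apply: (locally_finite_ext sR lR fM _ lQ) => //.
  by move=> x /fK.
by move=> x _; apply: p_group_pow.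
Qed.

Lemma class_bound (p c r : nat) : (1 < c)%N ->
  (c%:Q - 1 <= p%:Q ^ r%:Z)%R -> (c.-1 <= p ^ r)%N.
Proof.
case: c => // c _; rewrite -exprnP -!pmulrn -natr1 GRing.addrK -natrX.
by rewrite ler_nat.
Qed.

End Main.

Local Open Scope ring_scope.

(* The bounds on r are taken in rat because r = 0 (when c = 2) makes
   p^(r-1) = 1/p; since 1 <= c - 1, no negative integer r satisfies them. *)
Theorem theorem1p2 (p c r : nat) (hp : prime p) (hc : (1 < c)%N)
    (hr : p%:Q ^ (r%:Z - 1) < c%:Q - 1 <= p%:Q ^ r%:Z) :
  (forall G : groupType,
      p_group p G -> in_N2 c G -> locally_nilpotent G)
  <->
  (odd p ->
     forall G : groupType,
       p_group p G -> exponent_dvd (p ^ r)%N G -> in_N2 c G ->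
       locally_nilpotent G)
  /\
  (p = 2%N ->
     forall G : groupType,
       p_group 2 G -> exponent_dvd (2 ^ r.+1)%N G -> in_N2 c G ->
       locally_nilpotent G).
Proof.
split=> [all_p|[p_odd p_two]].
  by split=> [_|p2] G pG _ Gc; apply: all_p; rewrite ?p2.
have cpr : (c.-1 <= p ^ r)%N by apply: class_bound hc _; case/andP: hr.
apply: (locally_nilpotent_of_exponent hp hc cpr) => G.
rewrite /power_shift; case: eqVneq => [p2|pN2]; first by rewrite p2; apply: p_two.
by apply: p_odd; case: (even_prime hp) pN2 => // ->.
Qed.
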